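(* For each integer $n\ge 0$, the group $\mathfrak G_n$ has a normal subgroup $H_n$ of index $2^{2^{n+1}+2}$ which is isomorphic to the direct product of $2^n$ free groups of rank $3$.
   Context: Let $\mathfrak G_{-1}=\langle a,b,c,d\mid a^2=b^2=c^2=d^2=bcd=1\rangle$. Let $\sigma$ be the endomorphism of $\mathfrak G_{-1}$ defined by $\sigma(a)=aca$, $\sigma(b)=d$, $\sigma(c)=b$, $\sigma(d)=c$. Set $u_0=(ad)^4$, $v_0=(adacac)^4$, $u_n=\sigma^n(u_0)$, $v_n=\sigma^n(v_0)$ for $n\ge0$. For $n\ge 0$, $\mathfrak G_n$ is the group with presentation $\langle a,b,c,d\mid a^2=b^2=c^2=d^2=bcd=1,\ u_0=\dots=u_n=1,\ v_0=\dots=v_{n-1}=1\rangle$ (for $n=0$, no $v_i$ relators). (These groups converge to the Grigorchuk group, which has the Lysenok presentation with all relators $u_n,v_n$.) *)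

(* Defs.v *)
(* Finitely presented groups are modelled concretely:
   elements are words in generators and their formal inverses, and equality
   in the group  < X | R >  is the congruence [pres_eq R] generated by free
   cancellation and insertion/deletion of relators (so the group is
   F(X) / normal closure of R). *)
From Stdlib Require Import List Arith.
Import ListNotations.

Definition letter (X : Type) := (X * bool)%type.   (* (x,false)=x, (x,true)=x^-1 *)
Definition word (X : Type) := list (letter X).

Definition linv {X} (l : letter X) : letter X := (fst l, negb (snd l)).
Definition winv {X} (w : word X) : word X := rev (map linv w).

Inductive pres_eq {X : Type} (R : list (word X)) : word X -> word X -> Prop :=
| pe_refl w : pres_eq R w w
| pe_sym u v : pres_eq R u v -> pres_eq R v u
| pe_trans u v w : pres_eq R u v -> pres_eq R v w -> pres_eq R u w
| pe_cancel u v (x : letter X) : pres_eq R (u ++ x :: linv x :: v) (u ++ v)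
| pe_rel u v r : In r R -> pres_eq R (u ++ r ++ v) (u ++ v).

Definition normal_subgroup {X} (R : list (word X)) (H : word X -> Prop) : Prop :=
  (forall u v, H u -> pres_eq R u v -> H v) /\
  H [] /\
  (forall u v, H u -> H v -> H (u ++ v)) /\
  (forall u, H u -> H (winv u)) /\
  (forall g u, H u -> H (g ++ u ++ winv g)).

Definition has_index {X} (R : list (word X)) (H : word X -> Prop) (N : nat) : Prop :=
  exists reps : nat -> word X,
    (forall w, exists i, i < N /\ H (w ++ winv (reps i))) /\
    (forall i j, i < N -> j < N -> H (reps i ++ winv (reps j)) -> i = j).

Inductive gen3 := x1 | x2 | x3.
Definition F3_eq : word gen3 -> word gen3 -> Prop := pres_eq (@nil (word gen3)).

(* H (subgroup of < X | R >) is isomorphic to the direct product of k copies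
   of the free group of rank 3 (elements of the product: f : nat -> word gen3,
   components i < k). *)
Definition iso_prod_F3 {X} (R : list (word X)) (H : word X -> Prop) (k : nat) : Prop :=
  exists phi : word X -> nat -> word gen3,
    (forall u v, H u -> pres_eq R u v -> forall i, i < k -> F3_eq (phi u i) (phi v i)) /\
    (forall u v, H u -> H v -> forall i, i < k ->
        F3_eq (phi (u ++ v) i) (phi u i ++ phi v i)) /\
    (forall u, H u -> (forall i, i < k -> F3_eq (phi u i) []) -> pres_eq R u []) /\
    (forall g : nat -> word gen3, exists u, H u /\ forall i, i < k -> F3_eq (phi u i) (g i)).

Inductive gen := ga | gb | gc | gd.
Definition ltr (x : gen) : word gen := [(x, false)].
Definition A := ltr ga.
Definition B := ltr gb.
Definition C := ltr gc.
Definition D := ltr gd.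

Definition sigma_gen (x : gen) : word gen :=
  match x with
  | ga => A ++ C ++ A
  | gb => D
  | gc => B
  | gd => C
  end.
Definition sigma_word (w : word gen) : word gen :=
  flat_map (fun l : letter gen => if snd l then winv (sigma_gen (fst l)) else sigma_gen (fst l)) w.

Definition pow4 (w : word gen) : word gen := w ++ w ++ w ++ w.
Definition u0 : word gen := pow4 (A ++ D).
Definition v0 : word gen := pow4 (A ++ D ++ A ++ C ++ A ++ C).
Definition u_ (n : nat) : word gen := Nat.iter n sigma_word u0.
Definition v_ (n : nat) : word gen := Nat.iter n sigma_word v0.

Definition base_rels : list (word gen) :=
  [A ++ A; B ++ B; C ++ C; D ++ D; B ++ C ++ D].

Definition rels (n : nat) : list (word gen) :=
  base_rels ++ map u_ (seq 0 (S n)) ++ map v_ (seq 0 n).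

(* Main.v *)
(* [G_0] is the amalgam of the dihedral group [<a,d>] of order 8 and the Klein group
   [<b,c,d>] over [<d>]; it is the semidirect product of [<a,d>] with the free product of
   the four conjugates of [b], and [H_0] is the group of even words in these four
   involutions, free of rank 3 and of index 16.

   The wreath recursion [psi] maps the index-2 subgroup of [G_(n+1)] of words with an even
   number of [a] injectively into [G_n x G_n], and [H_(n+1)] is the preimage of [H_n x H_n].  For
   injectivity: [sigma] is a section of the second coordinate, and every even element is
   [a sigma(f) a sigma(g)] with [f] in the normal closure [B] of [b], because the relators
   [u_0, v_0] make [ada] commute with [sigma B]; applying [psi] recovers [f] and [g].

   For the index, [H_n] lies in the kernel of a map of [G_n] onto a group of order 16, and
   its index [e_n] in that kernel satisfies [e_(n+1) = 4 e_n^2]: under [psi], the kernel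
   for [G_(n+1)] is an extension of the product of two kernels for [G_n] by the cyclic
   group of order 4 generated by [abab]. *)
Require Import Defs.
From Stdlib Require Import List Arith Bool Lia Setoid Morphisms.
Import ListNotations.

Set Implicit Arguments.

(** * Calculus of words and inverses in a presented group *)

#[global] Instance pres_eq_equiv X (R : list (word X)) : Equivalence (pres_eq R).
Proof.
  split; [intros w; apply pe_refl | intros u v; apply pe_sym |
          intros u v w; apply pe_trans].
Qed.

Lemma pres_eq_app_l X (R : list (word X)) w u v :
  pres_eq R u v -> pres_eq R (w ++ u) (w ++ v).
Proof.
  induction 1.
  - reflexivity.
  - now symmetry.
  - etransitivity; eassumption.
  - rewrite !app_assoc. apply pe_cancel.
  - rewrite !(app_assoc w). now apply pe_rel.
Qed.

Lemma pres_eq_app_r X (R : list (word X)) w u v :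
  pres_eq R u v -> pres_eq R (u ++ w) (v ++ w).
Proof.
  induction 1.
  - reflexivity.
  - now symmetry.
  - etransitivity; eassumption.
  - rewrite <- !app_assoc. apply pe_cancel.
  - rewrite <- !app_assoc. now apply pe_rel.
Qed.

#[global] Instance pres_eq_app X (R : list (word X)) :
  Proper (pres_eq R ==> pres_eq R ==> pres_eq R) (@app (letter X)).
Proof.
  intros u u' Hu v v' Hv. transitivity (u' ++ v).
  - now apply pres_eq_app_r.
  - now apply pres_eq_app_l.
Qed.

Lemma relator_trivial X (R : list (word X)) r : In r R -> pres_eq R r [].
Proof. intros Hr. generalize (pe_rel R [] [] r Hr). now rewrite app_nil_r. Qed.

Lemma winv_app X (u v : word X) : winv (u ++ v) = winv v ++ winv u.
Proof. unfold winv. now rewrite map_app, rev_app_distr. Qed.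

Lemma linv_invol X (x : letter X) : linv (linv x) = x.
Proof. destruct x as [g e]. unfold linv. simpl. now rewrite negb_involutive. Qed.

Lemma winv_invol X (u : word X) : winv (winv u) = u.
Proof.
  unfold winv. rewrite map_rev, rev_involutive, map_map.
  rewrite <- (map_id u) at 2. apply map_ext. apply linv_invol.
Qed.

Lemma winv_r X (R : list (word X)) u : pres_eq R (u ++ winv u) [].
Proof.
  induction u as [|x u IH]; [reflexivity|].
  change (x :: u) with ([x] ++ u). rewrite winv_app, <- app_assoc, (app_assoc u).
  rewrite IH. exact (pe_cancel R [] [] x).
Qed.

Lemma winv_l X (R : list (word X)) u : pres_eq R (winv u ++ u) [].
Proof. rewrite <- (winv_invol u) at 2. apply winv_r. Qed.

(** * Rewriting in quotients of the free product of [<a>] and [<b,c,d>] *)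

Definition emb (w : list gen) : word gen := map (fun g => (g, false)) w.

Definition gen_eqb (x y : gen) : bool :=
  match x, y with
  | ga, ga | gb, gb | gc, gc | gd, gd => true
  | _, _ => false
  end.

Definition rule := (list gen * list gen)%type.

Fixpoint strip (l w : list gen) : option (list gen) :=
  match l, w with
  | [], _ => Some w
  | x :: l', y :: w' => if gen_eqb x y then strip l' w' else None
  | _ :: _, [] => None
  end.

Fixpoint rewrite_head (rs : list rule) (w : list gen) : option (list gen) :=
  match rs with
  | [] => None
  | (l, r) :: rs' =>
      match strip l w with
      | Some t => Some (r ++ t)
      | None => rewrite_head rs' w
      end
  end.

Fixpoint rewrite_once (rs : list rule) (w : list gen) : option (list gen) :=
  match rewrite_head rs w with
  | Some w' => Some w'
  | None =>
      match w with
      | [] => None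
      | x :: w' => option_map (cons x) (rewrite_once rs w')
      end
  end.

Fixpoint normalize (fuel : nat) (rs : list rule) (w : list gen) : list gen :=
  match fuel with
  | 0 => w
  | S k =>
      match rewrite_once rs w with
      | Some w' => normalize k rs w'
      | None => w
      end
  end.

Definition sound (R : list (word gen)) (rs : list rule) : Prop :=
  Forall (fun r => pres_eq R (emb (fst r)) (emb (snd r))) rs.

Lemma emb_app u v : emb (u ++ v) = emb u ++ emb v.
Proof. apply map_app. Qed.

Lemma strip_spec l w t : strip l w = Some t -> w = l ++ t.
Proof.
  revert w; induction l as [|x l IH]; intros [|y w] H; simpl in *; try congruence.
  destruct (gen_eqb x y) eqn:E; [|discriminate].
  rewrite (IH w H). f_equal. destruct x, y; simpl in E; congruence.
Qed.

Lemma rewrite_head_sound R rs w w' :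
  sound R rs -> rewrite_head rs w = Some w' -> pres_eq R (emb w) (emb w').
Proof.
  intros Hs. induction Hs as [|[l r] rs Hr Hs IH]; simpl; [discriminate|].
  destruct (strip l w) eqn:E; [|auto].
  intros H; injection H as <-. rewrite (strip_spec _ _ E), !emb_app.
  simpl in Hr. now rewrite Hr.
Qed.

Lemma rewrite_once_sound R rs w w' :
  sound R rs -> rewrite_once rs w = Some w' -> pres_eq R (emb w) (emb w').
Proof.
  intros Hs. revert w'. induction w as [|x w IH]; intros w'; simpl;
    destruct (rewrite_head rs _) eqn:E; try discriminate.
  - intros H; injection H as <-. now apply (rewrite_head_sound _ Hs E).
  - intros H; injection H as <-. now apply (rewrite_head_sound _ Hs E).
  - destruct (rewrite_once rs w) eqn:E'; simpl; [|discriminate].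
    intros H; injection H as <-.
    apply (pres_eq_app_l [(x, false)]). now apply IH.
Qed.

Lemma normalize_sound R rs k w :
  sound R rs -> pres_eq R (emb w) (emb (normalize k rs w)).
Proof.
  intros Hs. revert w. induction k as [|k IH]; intros w; simpl; [reflexivity|].
  destruct (rewrite_once rs w) eqn:E; [|reflexivity].
  rewrite (rewrite_once_sound _ Hs E). apply IH.
Qed.

Lemma involutive_letters R w : incl base_rels R -> pres_eq R w (emb (map fst w)).
Proof.
  intros HR. induction w as [|[g e] w IH]; [reflexivity|].
  change (pres_eq R ([(g, e)] ++ w) ([(g, false)] ++ emb (map fst w))).
  rewrite <- IH. destruct e; [|reflexivity]. apply pres_eq_app_r.
  assert (H : pres_eq R ([(g, false)] ++ [(g, false)]) []).
  { apply relator_trivial, HR. destruct g; simpl; tauto. }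
  transitivity ([(g, true)] ++ [(g, false)] ++ [(g, false)]);
    [now rewrite H | ].
  exact (pe_cancel R [] [(g, false)] (g, true)).
Qed.

(** Proof by reflection: each rewriting step preserves the group element, so agreement of the two
    computed words proves equality in the group. *)
Lemma normalize_eq R rs k u v :
  incl base_rels R -> sound R rs ->
  normalize k rs (map fst u) = normalize k rs (map fst v) -> pres_eq R u v.
Proof.
  intros HR Hs E. rewrite (involutive_letters u HR), (involutive_letters v HR).
  rewrite (normalize_sound k _ Hs), E. symmetry. now apply normalize_sound.
Qed.

(** [c] is eliminated as [db], and elements of the Klein group are written [d^i b^j]. *)
Definition base_rules : list rule :=
  [([ga; ga], []); ([gb; gb], []); ([gd; gd], []);
   ([gc], [gd; gb]); ([gb; gd], [gd; gb])].

Lemma base_rules_sound R : incl base_rels R -> sound R base_rules.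
Proof.
  intros HR.
  assert (H : forall r, In r base_rels -> pres_eq R r []).
  { intros r Hr. apply relator_trivial; auto. }
  assert (HA : pres_eq R (A ++ A) []) by (apply H; simpl; tauto).
  assert (HB : pres_eq R (B ++ B) []) by (apply H; simpl; tauto).
  assert (HC : pres_eq R (C ++ C) []) by (apply H; simpl; tauto).
  assert (HD : pres_eq R (D ++ D) []) by (apply H; simpl; tauto).
  assert (HBCD : pres_eq R (B ++ C ++ D) []) by (apply H; simpl; tauto).
  assert (Hbd : pres_eq R (B ++ D) C).
  { transitivity (B ++ (B ++ C ++ D) ++ D); [now rewrite HBCD|].
    transitivity ((B ++ B) ++ C ++ (D ++ D)); [now rewrite <- !app_assoc|].
    now rewrite HB, HD. }
  assert (Hdb : pres_eq R (D ++ B) C).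
  { transitivity (D ++ B ++ C ++ C); [now rewrite HC|].
    rewrite <- Hbd at 1.
    transitivity (D ++ (B ++ B) ++ D ++ C); [now rewrite <- !app_assoc|].
    rewrite HB. transitivity ((D ++ D) ++ C); [now rewrite <- !app_assoc|].
    now rewrite HD. }
  repeat apply Forall_cons; try apply Forall_nil; try assumption.
  - now symmetry.
  - etransitivity; [exact Hbd | now symmetry].
Qed.

Lemma base_eq R u v :
  incl base_rels R ->
  normalize 100 base_rules (map fst u) = normalize 100 base_rules (map fst v) ->
  pres_eq R u v.
Proof. intros HR. now apply normalize_eq, base_rules_sound. Qed.

Lemma base_rels_incl n : incl base_rels (rels n).
Proof. apply incl_appl, incl_refl. Qed.

Lemma u_in n k : k <= n -> In (u_ k) (rels n).
Proof.
  intros H. unfold rels. rewrite !in_app_iff. right; left. apply in_map, in_seq. lia.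
Qed.

Lemma v_in n k : k < n -> In (v_ k) (rels n).
Proof.
  intros H. unfold rels. rewrite !in_app_iff. right; right. apply in_map, in_seq. lia.
Qed.

Lemma da_braid n : pres_eq (rels n) (D ++ A ++ D ++ A) (A ++ D ++ A ++ D).
Proof.
  transitivity ((D ++ A ++ D ++ A) ++ u0).
  - rewrite (relator_trivial _ _ (u_in (Nat.le_0_l n))). now rewrite app_nil_r.
  - apply base_eq; [apply base_rels_incl | reflexivity].
Qed.

(** The relator [u_0] reads [dada = adad]; the last rule resolves its overlap [bdada] with
    [bd = db]. *)
Definition rules : list rule :=
  base_rules ++ [([gd; ga; gd; ga], [ga; gd; ga; gd]);
                 ([gb; ga; gd; ga; gd], [gd; gb; ga; gd; ga])].

Lemma rules_sound n : sound (rels n) rules.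
Proof.
  apply Forall_app; split; [apply base_rules_sound, base_rels_incl|].
  constructor; [apply da_braid|]. constructor; [|constructor]. simpl.
  change (pres_eq (rels n) (B ++ (A ++ D ++ A ++ D)) (D ++ B ++ A ++ D ++ A)).
  rewrite <- da_braid. apply base_eq; [apply base_rels_incl | reflexivity].
Qed.

Lemma rules_eq n u v :
  normalize 100 rules (map fst u) = normalize 100 rules (map fst v) ->
  pres_eq (rels n) u v.
Proof. apply normalize_eq; [apply base_rels_incl | apply rules_sound]. Qed.

(** * The finite quotient of order 16 and the group [G_0] *)

(* [(s, x, y, g)] stands for [b^g d^x (ada)^y a^s]; the first three coordinates form
   the dihedral group [<a,d>] of order 8, seen as the wreath product of two groups of
   order 2. *)
Definition Q := (bool * bool * bool * bool)%type.

Definition qmul (p q : Q) : Q :=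
  let '(s, x, y, g) := p in
  let '(s', x', y', g') := q in
  (xorb s s', xorb x (if s then y' else x'), xorb y (if s then x' else y'), xorb g g').

Arguments qmul : simpl never.

Definition q1 : Q := (false, false, false, false).

Definition qgen (l : gen) : Q :=
  match l with
  | ga => (true, false, false, false)
  | gb => (false, false, false, true)
  | gc => (false, true, false, true)
  | gd => (false, true, false, false)
  end.

Fixpoint cls (w : word gen) : Q :=
  match w with
  | [] => q1
  | l :: w' => qmul (qgen (fst l)) (cls w')
  end.

Ltac cases :=
  repeat match goal with
    | q : Q |- _ => destruct q as [[[? ?] ?] ?]
    | b : bool |- _ => destruct b
    end.

Lemma qmul_assoc p q r : qmul p (qmul q r) = qmul (qmul p q) r.
Proof.
  destruct p as [[[s x] y] g], q as [[[s' x'] y'] g'], r as [[[s'' x''] y''] g''].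
  destruct s, s', s''; unfold qmul; now rewrite !xorb_assoc.
Qed.

Lemma qmul_1l q : qmul q1 q = q.
Proof. cases; reflexivity. Qed.

Lemma qmul_1r q : qmul q q1 = q.
Proof. cases; reflexivity. Qed.

Definition qinv (q : Q) : Q :=
  let '(s, x, y, g) := q in (s, if s then y else x, if s then x else y, g).

Lemma qmul_Vl q : qmul (qinv q) q = q1.
Proof. cases; reflexivity. Qed.

Lemma qmul_Vr q : qmul q (qinv q) = q1.
Proof. cases; reflexivity. Qed.

Lemma cls_app u v : cls (u ++ v) = qmul (cls u) (cls v).
Proof.
  induction u as [|l u IH]; simpl; [now rewrite qmul_1l|].
  now rewrite IH, qmul_assoc.
Qed.

Lemma cls_winv u : cls (winv u) = qinv (cls u).
Proof.
  assert (H : qmul (cls (winv u)) (cls u) = q1).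
  { induction u as [|[l e] u IH]; [reflexivity|].
    change ((l, e) :: u) with ([(l, e)] ++ u). rewrite winv_app, !cls_app.
    rewrite <- qmul_assoc, (qmul_assoc (cls (winv [(l, e)]))).
    replace (qmul (cls (winv [(l, e)])) (cls [(l, e)])) with q1;
      [now rewrite qmul_1l | now destruct l]. }
  rewrite <- (qmul_1l (qinv (cls u))), <- H, <- qmul_assoc, qmul_Vr.
  now rewrite qmul_1r.
Qed.

(** [Q] is the product of a dihedral group of order 8 with a group of order 2, hence of exponent 4.
    All [u_k] and [v_k] are fourth powers, so they die in [Q]. *)
Lemma cls_pow4 w : cls (pow4 w) = q1.
Proof. unfold pow4. rewrite !cls_app. generalize (cls w) as q. intros; cases; reflexivity. Qed.

(* The conjugates of [b] under the dihedral group: they freely generate, as involutions,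
   the normal closure of [b] in [G_0]. *)
Inductive vertex := V0 | V1 | V2 | V3.

Definition conj_b (i : vertex) : word gen :=
  match i with
  | V0 => B
  | V1 => A ++ B ++ A
  | V2 => D ++ A ++ B ++ A ++ D
  | V3 => A ++ D ++ A ++ B ++ A ++ D ++ A
  end.

(** The index of the conjugate of [b] by the dihedral part of [q]. Since [d] commutes with [b] and
    [ada] with [aba], only one of [x], [y] matters for each [s]. *)
Definition act (q : Q) : vertex :=
  let '(s, x, y, _) := q in
  if s then (if x then V2 else V1) else (if y then V3 else V0).

Definition sect (q : Q) : word gen :=
  let '(s, x, y, g) := q in
  (if g then B else []) ++ (if x then D else []) ++
  (if y then A ++ D ++ A else []) ++ (if s then A else []).

Lemma cls_sect q : cls (sect q) = q.
Proof. cases; reflexivity. Qed.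

Definition vgen (i : vertex) (e : bool) : word gen3 :=
  match i with
  | V0 => []
  | V1 => [(x1, e)]
  | V2 => [(x2, e)]
  | V3 => [(x3, e)]
  end.

(** A conjugate of [b] met after an even number of others opens a pair [b_i b_j] and contributes
    [x_i^-1]; otherwise it closes one and contributes [x_j]. The letter [c = db] meets the same
    conjugate as [b], because [d] centralizes [b]. *)
Definition out (q : Q) (l : gen) : word gen3 :=
  match l with
  | gb | gc => vgen (act q) (negb (snd q))
  | _ => []
  end.

(* On the subgroup of even products of the involutions [b_i = conj_b i], this is the
   isomorphism with the free group on the [x_i = b_0 b_i], where [b_i b_j = x_i^-1 x_j]
   and [x_0 = 1]; elsewhere it is only a crossed homomorphism. *)
Fixpoint phi0 (q : Q) (w : word gen) : word gen3 :=
  match w with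
  | [] => []
  | l :: w' => out q (fst l) ++ phi0 (qmul q (qgen (fst l))) w'
  end.

Lemma phi0_app q u v : phi0 q (u ++ v) = phi0 q u ++ phi0 (qmul q (cls u)) v.
Proof.
  revert q; induction u as [|l u IH]; intros q; simpl; [now rewrite qmul_1r|].
  now rewrite IH, <- app_assoc, <- qmul_assoc.
Qed.

Definition back_vertex (x : gen3) : vertex :=
  match x with x1 => V1 | x2 => V2 | x3 => V3 end.

Definition back_letter (l : letter gen3) : word gen :=
  let b := conj_b (back_vertex (fst l)) in
  if snd l then b ++ B else B ++ b.

Definition back (w : word gen3) : word gen := flat_map back_letter w.

Lemma back_app u v : back (u ++ v) = back u ++ back v.
Proof. apply flat_map_app. Qed.

Lemma back_resp n u v : F3_eq u v -> pres_eq (rels n) (back u) (back v).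
Proof.
  induction 1.
  - reflexivity.
  - now symmetry.
  - etransitivity; eassumption.
  - change (x :: linv x :: v) with ([x; linv x] ++ v). rewrite !back_app.
    assert (H : pres_eq (rels n) (back [x; linv x]) []).
    { apply rules_eq. destruct x as [[] []]; reflexivity. }
    now rewrite H.
  - easy.
Qed.

Lemma cls_back g : cls (back g) = q1.
Proof.
  induction g as [|l g IH]; [reflexivity|].
  simpl. rewrite cls_app, IH. destruct l as [[] []]; reflexivity.
Qed.

Lemma phi0_back g : phi0 q1 (back g) = g.
Proof.
  induction g as [|l g IH]; [reflexivity|].
  simpl. rewrite phi0_app.
  replace (qmul q1 (cls (back_letter l))) with q1 by (destruct l as [[] []]; reflexivity).
  rewrite IH. destruct l as [[] []]; reflexivity.
Qed.

(** Appending a letter to a coset representative yields another one, up to a factor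
    [back (out q l)]; these finitely many identities follow from [u_0] and the base relators, hence
    hold in every [G_n]. *)
Lemma normal_form n w :
  pres_eq (rels n) w (back (phi0 q1 w) ++ sect (cls w)).
Proof.
  induction w as [|l w IH] using rev_ind; [reflexivity|].
  rewrite phi0_app, cls_app, back_app, qmul_1l.
  rewrite IH at 1. rewrite <- !app_assoc. apply pres_eq_app_l.
  generalize (cls w) as q. intros q. apply rules_eq.
  destruct l as [[] e]; cases; reflexivity.
Qed.

Lemma phi0_relator q r : In r (rels 0) -> F3_eq (phi0 q r) [] /\ cls r = q1.
Proof.
  intros Hr. split.
  - assert (H : forall i e, F3_eq (vgen i e ++ vgen i (negb e)) []).
    { intros [] e; try reflexivity; exact (pe_cancel [] [] [] _). }
    simpl in Hr. repeat destruct Hr as [<-|Hr]; try easy; cases;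
    first [reflexivity | exact (pe_cancel [] [] [] _)].
  - simpl in Hr. repeat destruct Hr as [<-|Hr]; easy.
Qed.

(** The starting class is arbitrary because a suffix is read from the class reached by its
    prefix. *)
Lemma phi0_resp u v :
  pres_eq (rels 0) u v -> cls u = cls v /\ forall q, F3_eq (phi0 q u) (phi0 q v).
Proof.
  induction 1 as [ | u v _ [] | u v w _ [] _ [] | u v l | u v r Hr].
  - now split.
  - split; [congruence|]. now symmetry.
  - split; [congruence|]. intros q. etransitivity; eauto.
  - change (l :: linv l :: v) with ([l; linv l] ++ v).
    assert (Hc : cls [l; linv l] = q1) by (destruct l as [[] e]; reflexivity).
    split; [now rewrite !cls_app, Hc, qmul_1l|].
    intros q. rewrite !phi0_app, Hc, qmul_1r.
    generalize (qmul q (cls u)) as q'. intros q'. apply pres_eq_app_l.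
    transitivity ([] ++ phi0 q' v); [|reflexivity]. apply pres_eq_app_r.
    destruct l as [[] e]; cases;
    first [reflexivity | exact (pe_cancel [] [] [] _)].
  - destruct (phi0_relator q1 Hr) as [_ Hc].
    split; [now rewrite !cls_app, Hc, qmul_1l|].
    intros q. rewrite !phi0_app, Hc, qmul_1r.
    destruct (phi0_relator (qmul q (cls u)) Hr) as [H _].
    apply pres_eq_app_l. now rewrite H.
Qed.

(** * The maps [sigma] and [psi] *)

Definition is_a (l : letter gen) : bool :=
  match fst l with ga => true | _ => false end.

Fixpoint par (w : word gen) : bool :=
  match w with
  | [] => false
  | l :: w' => xorb (is_a l) (par w')
  end.

Definition psi_letter (s : bool) (l : letter gen) : word gen :=
  let (g, e) := l in
  match g with
  | ga => []
  | gb => [(if s then gc else ga, e)]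
  | gc => [(if s then gd else ga, e)]
  | gd => if s then [(gb, e)] else []
  end.

(* On even words, [psi false] and [psi true] are the two coordinates of the wreath
   recursion [b -> (a,c), c -> (a,d), d -> (1,b)], with [a] swapping the coordinates. *)
Fixpoint psi (s : bool) (w : word gen) : word gen :=
  match w with
  | [] => []
  | l :: w' => psi_letter s l ++ psi (xorb s (is_a l)) w'
  end.

Lemma par_app u v : par (u ++ v) = xorb (par u) (par v).
Proof. induction u as [|l u IH]; simpl; [easy|]. now rewrite IH, xorb_assoc. Qed.

Lemma par_winv u : par (winv u) = par u.
Proof.
  induction u as [|l u IH]; [reflexivity|].
  change (l :: u) with ([l] ++ u). rewrite winv_app, !par_app, IH.
  apply xorb_comm.
Qed.

Lemma psi_app s u v : psi s (u ++ v) = psi s u ++ psi (xorb s (par u)) v.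
Proof.
  revert s; induction u as [|l u IH]; intros s; simpl; [now rewrite xorb_false_r|].
  now rewrite IH, <- app_assoc, xorb_assoc.
Qed.

Lemma psi_winv s u : psi s (winv u) = winv (psi (xorb s (par u)) u).
Proof.
  revert s; induction u as [|l u IH]; intros s; [reflexivity|].
  change (l :: u) with ([l] ++ u).
  rewrite winv_app, !psi_app, winv_app, IH, par_winv, par_app, !xorb_assoc.
  destruct l as [[] e], s, (par u), e; reflexivity.
Qed.

Lemma sigma_app u v : sigma_word (u ++ v) = sigma_word u ++ sigma_word v.
Proof. apply flat_map_app. Qed.

Lemma sigma_pow4 w : sigma_word (pow4 w) = pow4 (sigma_word w).
Proof. unfold pow4. now rewrite !sigma_app. Qed.

Lemma iter_sigma_pow4 k w :
  Nat.iter k sigma_word (pow4 w) = pow4 (Nat.iter k sigma_word w).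
Proof. induction k as [|k IH]; simpl; [easy|]. now rewrite IH, sigma_pow4. Qed.

Lemma par_sigma w : par (sigma_word w) = false.
Proof.
  induction w as [|l w IH]; [reflexivity|].
  change (l :: w) with ([l] ++ w). rewrite sigma_app, par_app, IH.
  destruct l as [[] []]; reflexivity.
Qed.

Lemma psi_sigma w : psi true (sigma_word w) = w.
Proof.
  induction w as [|l w IH]; [reflexivity|].
  change (l :: w) with ([l] ++ w).
  rewrite sigma_app, psi_app, par_sigma, xorb_false_r, IH.
  destruct l as [[] []]; reflexivity.
Qed.

(** The homomorphism [a -> d], [b -> 1], [c, d -> a], with values in the dihedral group. *)
Definition tau (w : word gen) : word gen := psi false (sigma_word w).

Lemma tau_app u v : tau (u ++ v) = tau u ++ tau v.
Proof. unfold tau. now rewrite sigma_app, psi_app, par_sigma. Qed.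

(* The automorphism of the dihedral group exchanging [a] and [d]. *)
Definition theta (q : Q) : Q :=
  let '(s, x, y, _) := q in
  qmul (if x then qgen ga else q1)
    (qmul (if y then (true, true, true, false) else q1) (if s then qgen gd else q1)).

Lemma theta_mul p q : theta (qmul p q) = qmul (theta p) (theta q).
Proof. cases; reflexivity. Qed.

Lemma cls_tau w : cls (tau w) = theta (cls w).
Proof.
  induction w as [|l w IH]; [reflexivity|].
  change (l :: w) with ([l] ++ w).
  rewrite tau_app, !cls_app, theta_mul, IH.
  f_equal. destruct l as [[] []]; reflexivity.
Qed.

Lemma phi0_tau q w : phi0 q (tau w) = [].
Proof.
  revert q; induction w as [|l w IH]; intros q; [reflexivity|].
  change (l :: w) with ([l] ++ w). rewrite tau_app, phi0_app, IH.
  destruct l as [[] []]; reflexivity.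
Qed.

(** Membership in the normal closure of [b], seen as the kernel of the projection to the dihedral
    group. *)
Definition in_B (w : word gen) : Prop := exists g, cls w = (false, false, false, g).

Lemma in_B_app u v : in_B u -> in_B v -> in_B (u ++ v).
Proof.
  intros [g Hg] [h Hh]. exists (xorb g h). now rewrite cls_app, Hg, Hh.
Qed.

(** As a word in [a] and [d], [tau w] has a normal form without free part, and [theta] kills the
    class of [w]. *)
Lemma tau_trivial n w : in_B w -> pres_eq (rels n) (tau w) [].
Proof.
  intros [g Hw]. rewrite (normal_form n (tau w)), phi0_tau, cls_tau, Hw. reflexivity.
Qed.

Lemma cls_relator n r : In r (rels n) -> cls r = q1.
Proof.
  intros Hr. unfold rels in Hr. rewrite !in_app_iff, !in_map_iff in Hr.
  destruct Hr as [Hr | [[k [<- _]] | [k [<- _]]]].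
  - simpl in Hr. repeat destruct Hr as [<-|Hr]; easy.
  - unfold u_, u0. rewrite iter_sigma_pow4. apply cls_pow4.
  - unfold v_, v0. rewrite iter_sigma_pow4. apply cls_pow4.
Qed.

(** The recursion that makes both [sigma] and [psi] well defined between consecutive levels: the
    long relators are shifted by [sigma], and [u_0], [v_0] are put back. *)
Lemma rels_S n r :
  In r (rels (S n)) <->
  In r base_rels \/ r = u0 \/ r = v0 \/
  exists k, (k <= n /\ r = sigma_word (u_ k)) \/ (k < n /\ r = sigma_word (v_ k)).
Proof.
  unfold rels. rewrite !in_app_iff, !in_map_iff. split.
  - intros [Hr | [[[|k] [<- Hk]] | [[|k] [<- Hk]]]];
      [tauto | auto | | auto |]; rewrite in_seq in Hk.
    + do 3 right. exists k. left. split; [lia | easy].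
    + do 3 right. exists k. right. split; [lia | easy].
  - intros [Hr | [-> | [-> | [k [[Hk ->] | [Hk ->]]]]]]; [tauto | right..].
    + left. exists 0. rewrite in_seq. split; [easy | lia].
    + right. exists 0. rewrite in_seq. split; [easy | lia].
    + left. exists (S k). rewrite in_seq. split; [easy | lia].
    + right. exists (S k). rewrite in_seq. split; [easy | lia].
Qed.

Lemma sigma_resp n u v :
  pres_eq (rels n) u v -> pres_eq (rels (S n)) (sigma_word u) (sigma_word v).
Proof.
  induction 1 as [ | | | u v l | u v r Hr].
  - reflexivity.
  - now symmetry.
  - etransitivity; eassumption.
  - change (l :: linv l :: v) with ([l; linv l] ++ v). rewrite !sigma_app.
    apply pres_eq_app_l. rewrite <- (app_nil_l (sigma_word v)) at 2.
    apply pres_eq_app_r, rules_eq. destruct l as [[] []]; reflexivity.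
  - rewrite !sigma_app. apply pres_eq_app_l.
    rewrite <- (app_nil_l (sigma_word v)) at 2. apply pres_eq_app_r.
    unfold rels in Hr. rewrite !in_app_iff, !in_map_iff in Hr.
    destruct Hr as [Hr | [[k [<- Hk]] | [k [<- Hk]]]].
    + apply rules_eq. simpl in Hr. repeat destruct Hr as [<-|Hr]; easy.
    + rewrite in_seq in Hk. apply relator_trivial, rels_S. do 3 right.
      exists k. left. split; [lia | easy].
    + rewrite in_seq in Hk. apply relator_trivial, rels_S. do 3 right.
      exists k. right. split; [lia | easy].
Qed.

Lemma psi_relator n r :
  In r (rels (S n)) -> par r = false /\ forall s, pres_eq (rels n) (psi s r) [].
Proof.
  assert (Hs : forall r', In r' (rels n) ->
    par (sigma_word r') = false /\ forall s, pres_eq (rels n) (psi s (sigma_word r')) []).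
  { intros r' Hr'. split; [apply par_sigma|]. intros [].
    - rewrite psi_sigma. now apply relator_trivial.
    - apply tau_trivial. exists false. exact (cls_relator Hr'). }
  rewrite rels_S. intros [Hr | [-> | [-> | [k [[Hk ->] | [Hk ->]]]]]].
  - simpl in Hr. repeat destruct Hr as [<-|Hr]; try easy;
    (split; [reflexivity | intros []; apply rules_eq; reflexivity]).
  (* Both coordinates of [u_0], and those of [v_0] below, reduce to squares of conjugates of [b]. *)
  - split; [reflexivity | intros []; apply rules_eq; reflexivity].
  - split; [reflexivity | intros []; apply rules_eq; reflexivity].
  - now apply Hs, u_in.
  - now apply Hs, v_in.
Qed.

Lemma psi_resp n u v :
  pres_eq (rels (S n)) u v ->
  par u = par v /\ forall s, pres_eq (rels n) (psi s u) (psi s v).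
Proof.
  induction 1 as [ | u v _ [] | u v w _ [] _ [] | u v l | u v r Hr].
  - now split.
  - split; [congruence|]. now symmetry.
  - split; [congruence|]. intros s. etransitivity; eauto.
  - change (l :: linv l :: v) with ([l; linv l] ++ v).
    assert (Hp : par [l; linv l] = false) by (destruct l as [[] e]; reflexivity).
    split; [now rewrite !par_app, Hp|].
    intros s. rewrite !psi_app, Hp, xorb_false_r. apply pres_eq_app_l.
    rewrite <- (app_nil_l (psi _ v)) at 2. apply pres_eq_app_r.
    generalize (xorb s (par u)) as t. intros t.
    apply rules_eq. destruct l as [[] e], t; reflexivity.
  - destruct (psi_relator Hr) as [Hp H].
    split; [now rewrite !par_app, Hp|].
    intros s. rewrite !psi_app, Hp, xorb_false_r. apply pres_eq_app_l. now rewrite H.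
Qed.

(** * Injectivity of [psi] *)

Definition commute X (R : list (word X)) (u v : word X) : Prop :=
  pres_eq R (u ++ v) (v ++ u).

Lemma commute_app X (R : list (word X)) u v w :
  commute R u v -> commute R u w -> commute R u (v ++ w).
Proof.
  unfold commute. intros Hv Hw.
  now rewrite app_assoc, Hv, <- !app_assoc, Hw.
Qed.

Lemma commute_nil X (R : list (word X)) u : commute R u [].
Proof. unfold commute. now rewrite app_nil_r. Qed.

Lemma commute_eq X (R : list (word X)) u v w :
  pres_eq R v w -> commute R u v -> commute R u w.
Proof. unfold commute. intros H Hv. now rewrite <- H. Qed.

(** The relators [u_0 = (ada d)^2] and [v_0 = (ada cacadacac)^2] say that the involution [ada]
    commutes with the images of [b_0] and [b_2]. It commutes with [sigma(a) = aca] since [c] and [d]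
    commute, hence also with the images of [b_1 = a b_0 a] and [b_3 = a b_2 a]. *)
Lemma commute_sigma_conj_b n i :
  commute (rels (S n)) (A ++ D ++ A) (sigma_word (conj_b i)).
Proof.
  assert (Haca : commute (rels (S n)) (A ++ D ++ A) (A ++ C ++ A)).
  { apply rules_eq. reflexivity. }
  assert (Hd : commute (rels (S n)) (A ++ D ++ A) D).
  { apply rules_eq. reflexivity. }
  assert (Hv : commute (rels (S n)) (A ++ D ++ A) (C ++ A ++ C ++ A ++ D ++ A ++ C ++ A ++ C)).
  { unfold commute. symmetry.
    transitivity (((C ++ A ++ C ++ A ++ D ++ A ++ C ++ A ++ C) ++ A ++ D ++ A) ++ v0).
    - rewrite (relator_trivial _ _ (v_in (Nat.lt_0_succ n))). now rewrite app_nil_r.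
    - apply base_eq; [apply base_rels_incl | reflexivity]. }
  destruct i.
  - exact Hd.
  - apply (commute_app Haca), (commute_app Hd Haca).
  - exact Hv.
  - apply (commute_app Haca), (commute_app Hv Haca).
Qed.

Lemma commute_sigma_back n g :
  commute (rels (S n)) (A ++ D ++ A) (sigma_word (back g)).
Proof.
  induction g as [|l g IH]; [apply commute_nil|].
  simpl. rewrite sigma_app. apply commute_app; [|exact IH].
  unfold back_letter.
  destruct (snd l); rewrite sigma_app; apply commute_app;
    try apply commute_sigma_conj_b; apply (commute_sigma_conj_b n V0).
Qed.

(* The normal closure of [b] is generated by the four conjugates [conj_b i]; its image
   under [sigma] commutes with [ada] thanks to the relators [u_0] and [v_0]. *)
Lemma commute_sigma_B n f :
  in_B f -> commute (rels (S n)) (A ++ D ++ A) (sigma_word f).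
Proof.
  intros [g Hf].
  apply commute_eq with (sigma_word (back (phi0 q1 f) ++ sect (cls f))).
  - apply sigma_resp. symmetry. apply normal_form.
  - rewrite sigma_app, Hf. apply commute_app; [apply commute_sigma_back|].
    destruct g; [apply (commute_sigma_conj_b n V0) | apply commute_nil].
Qed.

(** Conjugation by [a] swaps the coordinates of [psi], so this is a section of the first
    coordinate. *)
Definition twist (f : word gen) : word gen := A ++ sigma_word f ++ A.

Lemma par_twist f : par (twist f) = false.
Proof. unfold twist. now rewrite !par_app, par_sigma. Qed.

Lemma psi_twist s f :
  psi s (twist f) = if s then tau f else f.
Proof.
  unfold twist. rewrite !psi_app, par_sigma, app_nil_r.
  destruct s; [reflexivity | apply psi_sigma].
Qed.

Lemma twist_resp n u v :
  pres_eq (rels n) u v -> pres_eq (rels (S n)) (twist u) (twist v).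
Proof. intros H. unfold twist. now rewrite (sigma_resp H). Qed.

Lemma twist_app n u v : pres_eq (rels n) (twist u ++ twist v) (twist (u ++ v)).
Proof.
  unfold twist. rewrite sigma_app.
  transitivity (A ++ sigma_word u ++ (A ++ A) ++ sigma_word v ++ A);
    [now rewrite <- !app_assoc|].
  assert (H : pres_eq (rels n) (A ++ A) []) by (apply rules_eq; reflexivity).
  rewrite H. now rewrite <- !app_assoc.
Qed.

(** The middle factor is a variable on which normalization is stuck, so the two concrete sides are
    normalized separately. *)
Lemma rules_frame n u u' v v' F :
  normalize 100 rules (map fst u) = normalize 100 rules (map fst u') ->
  normalize 100 rules (map fst v) = normalize 100 rules (map fst v') ->
  pres_eq (rels n) (u ++ F ++ v) (u' ++ F ++ v').
Proof. intros Hu Hv. now rewrite (rules_eq n _ _ Hu), (rules_eq n _ _ Hv). Qed.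

Lemma twist_d n f : in_B f -> pres_eq (rels (S n)) (D ++ twist f) (twist f ++ D).
Proof.
  intros Hf. pose proof (commute_sigma_B n Hf) as H. unfold commute in H. unfold twist.
  transitivity ((A ++ A ++ D ++ A) ++ sigma_word f ++ A);
    [now apply (rules_frame _ (D ++ A) _ A)|].
  transitivity (A ++ ((A ++ D ++ A) ++ sigma_word f) ++ A);
    [now rewrite <- !app_assoc|].
  rewrite H.
  transitivity (A ++ sigma_word f ++ ((A ++ D ++ A) ++ A));
    [now rewrite <- !app_assoc|].
  transitivity (A ++ sigma_word f ++ (A ++ D));
    [now apply rules_frame | now rewrite <- !app_assoc].
Qed.

(** Since [c = a sigma(a) a] and, for the next lemma, [aca = a sigma(d) a], conjugation by these
    elements passes inside [twist]. *)
Lemma twist_c n f :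
  pres_eq (rels n) (C ++ twist f) (twist (A ++ f ++ A) ++ C).
Proof.
  unfold twist. rewrite !sigma_app.
  transitivity ((A ++ sigma_word A) ++ sigma_word f ++ (sigma_word A ++ A ++ C));
    [now apply (rules_frame _ (C ++ A) _ A) | now rewrite <- !app_assoc].
Qed.

Lemma twist_aca n f :
  pres_eq (rels n) ((A ++ C ++ A) ++ twist f) (twist (D ++ f ++ D) ++ A ++ C ++ A).
Proof.
  unfold twist. rewrite !sigma_app.
  transitivity ((A ++ sigma_word D) ++ sigma_word f ++ (sigma_word D ++ A ++ A ++ C ++ A));
    [now apply (rules_frame _ ((A ++ C ++ A) ++ A) _ A) | now rewrite <- !app_assoc].
Qed.

Lemma in_B_conj u f :
  qmul (cls u) (cls u) = q1 -> in_B f -> in_B (u ++ f ++ u).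
Proof.
  intros Hu [g Hf]. exists g. rewrite !cls_app, Hf.
  revert Hu. generalize (cls u) as q. intros q. cases; easy.
Qed.

(** The image of [sigma] is generated by [aca], [d], [b = cd] and [c], each of which normalizes the
    twisted copy of the normal closure of [b]. *)
Lemma sigma_twist n g f :
  in_B f -> exists f', in_B f' /\
  pres_eq (rels (S n)) (sigma_word g ++ twist f) (twist f' ++ sigma_word g).
Proof.
  intros Hf. induction g as [|[l e] g IH].
  { exists f. split; [exact Hf|]. simpl. now rewrite app_nil_r. }
  destruct IH as [f1 [Hf1 IH]].
  assert (Hl : exists f2, in_B f2 /\
    pres_eq (rels (S n)) (sigma_word (ltr l) ++ twist f1) (twist f2 ++ sigma_word (ltr l))).
  { destruct l.
    - exists (D ++ f1 ++ D). split; [now apply in_B_conj | apply twist_aca].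
    - exists f1. split; [exact Hf1 | now apply twist_d].
    - exists (A ++ f1 ++ A). split; [now apply in_B_conj|].
      change (sigma_word (ltr gc)) with B.
      assert (H : pres_eq (rels (S n)) B (C ++ D)) by (apply rules_eq; reflexivity).
      now rewrite H, <- app_assoc, twist_d, !app_assoc, twist_c.
    - exists (A ++ f1 ++ A). split; [now apply in_B_conj | apply twist_c]. }
  destruct Hl as [f2 [Hf2 Hl]]. exists f2. split; [exact Hf2|].
  change ((l, e) :: g) with ([(l, e)] ++ g). rewrite sigma_app.
  assert (He : pres_eq (rels (S n)) (sigma_word [(l, e)]) (sigma_word (ltr l))).
  { apply rules_eq. destruct l, e; reflexivity. }
  now rewrite He, <- app_assoc, IH, !app_assoc, Hl.
Qed.

Lemma even_decomposition n w :
  exists f g, in_B f /\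
  pres_eq (rels (S n)) w (twist f ++ sigma_word g ++ if par w then A else []).
Proof.
  induction w as [|[l e] w IH] using rev_ind.
  { exists [], []. split; [now exists false|]. apply rules_eq. reflexivity. }
  destruct IH as [f [g [Hf IH]]].
  assert (Hc : forall f' g', in_B f' ->
    pres_eq (rels (S n)) ((if par w then A else []) ++ ltr l)
      (twist f' ++ sigma_word g' ++ if par (w ++ [(l, e)]) then A else []) ->
    exists f g, in_B f /\
    pres_eq (rels (S n)) (w ++ [(l, e)])
      (twist f ++ sigma_word g ++ if par (w ++ [(l, e)]) then A else [])).
  { intros f' g' Hf' H.
    destruct (sigma_twist n g Hf') as [f'' [Hf'' H']].
    exists (f ++ f''), (g ++ g'). split; [now apply in_B_app|].
    revert H. generalize (par (w ++ [(l, e)])) as p. intros p H.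
    transitivity (w ++ ltr l).
    { apply pres_eq_app_l, (involutive_letters [(l, e)]), base_rels_incl. }
    rewrite IH, <- !app_assoc, H, (app_assoc (sigma_word g)), H'.
    now rewrite sigma_app, <- twist_app, <- !app_assoc. }
  assert (HB : in_B B) by now exists true.
  assert (H1 : in_B []) by now exists false.
  (* After an odd word: [ab = twist(b) sigma(a) a], [ac = sigma(a) a], [ad = twist(b) a]. After an
     even one: [b = sigma(c)], [c = sigma(d)], [d = sigma(b)]. *)
  rewrite par_app in *. destruct (par w), l.
  - apply (Hc [] [] H1), rules_eq. reflexivity.
  - apply (Hc B A HB), rules_eq. reflexivity.
  - apply (Hc [] A H1), rules_eq. reflexivity.
  - apply (Hc B [] HB), rules_eq. reflexivity.
  - apply (Hc [] [] H1), rules_eq. reflexivity.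
  - apply (Hc [] C H1), rules_eq. reflexivity.
  - apply (Hc [] D H1), rules_eq. reflexivity.
  - apply (Hc [] B H1), rules_eq. reflexivity.
Qed.

Lemma psi_injective n w :
  par w = false -> (forall s, pres_eq (rels n) (psi s w) []) -> pres_eq (rels (S n)) w [].
Proof.
  intros Hp Hpsi. destruct (even_decomposition n w) as [f [g [Hf Hw]]].
  rewrite Hp, app_nil_r in Hw.
  assert (Hs : forall s, pres_eq (rels n) (psi s (twist f ++ sigma_word g)) []).
  { intros s. rewrite <- (proj2 (psi_resp Hw)). apply Hpsi. }
  (* The second coordinate is [tau f] times [g], and [tau] kills [f]. *)
  assert (Hg : pres_eq (rels n) g []).
  { rewrite <- (Hs true), psi_app, par_twist, psi_twist, psi_sigma.
    now rewrite tau_trivial. }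
  assert (Hw' : pres_eq (rels (S n)) w (twist f)).
  { rewrite Hw, (sigma_resp Hg). change (sigma_word []) with (@nil (letter gen)).
    now rewrite app_nil_r. }
  assert (Hf1 : pres_eq (rels n) f []).
  { rewrite <- (Hpsi false), (proj2 (psi_resp Hw')). now rewrite psi_twist. }
  rewrite Hw', (twist_resp Hf1). apply rules_eq. reflexivity.
Qed.

(** * The subgroups [H_n] *)

Fixpoint Hsub (n : nat) (w : word gen) : Prop :=
  match n with
  | 0 => cls w = q1
  | S m => par w = false /\ forall s, Hsub m (psi s w)
  end.

Lemma Hsub_resp n u v : pres_eq (rels n) u v -> Hsub n u -> Hsub n v.
Proof.
  revert u v; induction n as [|n IH]; intros u v E; simpl.
  - destruct (phi0_resp E) as [-> _]. easy.
  - destruct (psi_resp E) as [-> H]. intros [Hp Hs]. split; [easy|].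
    intros s. exact (IH _ _ (H s) (Hs s)).
Qed.

Lemma Hsub_nil n : Hsub n [].
Proof. induction n; now simpl. Qed.

Lemma Hsub_app n u v : Hsub n u -> Hsub n v -> Hsub n (u ++ v).
Proof.
  revert u v; induction n as [|n IH]; intros u v; simpl.
  - rewrite cls_app. now intros -> ->.
  - intros [Hu Hu'] [Hv Hv']. split; [now rewrite par_app, Hu, Hv|].
    intros s. rewrite psi_app, Hu, xorb_false_r. auto.
Qed.

Lemma Hsub_winv n u : Hsub n u -> Hsub n (winv u).
Proof.
  revert u; induction n as [|n IH]; intros u; simpl.
  - rewrite cls_winv. now intros ->.
  - intros [Hu Hu']. split; [now rewrite par_winv|].
    intros s. rewrite psi_winv. auto.
Qed.

Lemma Hsub_conj n g u : Hsub n u -> Hsub n (g ++ u ++ winv g).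
Proof.
  revert g u; induction n as [|n IH]; intros g u; simpl.
  - rewrite !cls_app, cls_winv. intros ->. now rewrite qmul_1l, qmul_Vr.
  - intros [Hu Hu']. split.
    + rewrite !par_app, par_winv, Hu. simpl. apply xorb_nilpotent.
    + intros s. rewrite !psi_app, psi_winv, Hu, xorb_false_r.
      rewrite xorb_assoc, xorb_nilpotent, xorb_false_r. auto.
Qed.

Lemma Hsub_normal n : normal_subgroup (rels n) (Hsub n).
Proof.
  repeat split.
  - intros u v Hu E. now apply (Hsub_resp E).
  - apply Hsub_nil.
  - apply Hsub_app.
  - apply Hsub_winv.
  - apply Hsub_conj.
Qed.

(** Homomorphisms to the group of order 2: [beta] counts the letters [b] and [d], [delta] the
    letters [c] and [d]. *)
Definition beta (q : Q) : bool := let '(s, x, y, g) := q in xorb g (xorb x y).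
Definition delta (q : Q) : bool := let '(s, x, y, g) := q in xorb x y.

(** In the coordinate where [b], [c], [d] become [c], [d], [b], the letters counted by [beta] come
    from [c] and [d], those counted by [delta] from [b] and [c]. *)
Lemma cls_psi w :
  cls w = (par w, beta (cls (psi true w)), beta (cls (psi false w)),
           xorb (delta (cls (psi true w))) (delta (cls (psi false w)))).
Proof.
  induction w as [|l w IH] using rev_ind; [reflexivity|].
  rewrite !cls_app, IH, !psi_app, !par_app, !cls_app.
  generalize (cls (psi true w)) as p, (cls (psi false w)) as q. intros p q.
  destruct l as [[] e], (par w); cases; reflexivity.
Qed.

(** The pairs [(a,c)], [(a,d)], [(1,b)] have dihedral parts [(a,d)], [(a,d)], [(1,1)], exchanged by
    [theta]; applying [theta] twice only forgets the [b] component. *)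
Lemma theta_psi s w : theta (cls (psi s w)) = theta (theta (cls (psi (negb s) w))).
Proof.
  revert s; induction w as [|l w IH]; intros s; [now destruct s|].
  simpl. rewrite !cls_app, !theta_mul, (IH (xorb s (is_a l))), negb_xorb_l.
  f_equal. destruct l as [[] e], s; reflexivity.
Qed.

Lemma Hsub_cls n w : Hsub n w -> cls w = q1.
Proof.
  revert w; induction n as [|n IH]; intros w; [easy|].
  intros [Hp Hs]. now rewrite cls_psi, Hp, !(IH _ (Hs _)).
Qed.

Lemma winv_resp X (R : list (word X)) u v :
  pres_eq R u v -> pres_eq R (winv u) (winv v).
Proof.
  intros H. rewrite <- (app_nil_r (winv u)), <- (winv_r R v), app_assoc.
  rewrite <- H at 1. now rewrite winv_l.
Qed.

(** * The index of [H_n] *)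

Fixpoint rho (k : nat) : word gen :=
  match k with
  | 0 => []
  | S k' => A ++ B ++ A ++ B ++ rho k'
  end.

Lemma lt_4 k : k < 4 -> k = 0 \/ k = 1 \/ k = 2 \/ k = 3.
Proof. lia. Qed.

(** Triviality of the class and [theta_psi] leave four pairs of coordinate classes, those of the
    powers of [abab], which has coordinates [(ca, ac)]. *)
Lemma psi_q1_rho w :
  cls w = q1 ->
  exists k, k < 4 /\ forall s, cls (psi s w) = cls (psi s (rho k)).
Proof.
  intros H. pose proof (theta_psi true w) as Ht. revert H Ht. rewrite cls_psi. simpl negb.
  assert (Hk : forall p q, beta p = false -> beta q = false -> xorb (delta p) (delta q) = false ->
    theta p = theta (theta q) -> exists k, k < 4 /\
    p = cls (psi true (rho k)) /\ q = cls (psi false (rho k))).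
  { intros p q; cases; intros; try discriminate;
    first [ exists 0; now repeat constructor | exists 1; now repeat constructor
          | exists 2; now repeat constructor | exists 3; now repeat constructor ]. }
  intros H Ht. injection H as _ H1 H2 H3.
  destruct (Hk _ _ H1 H2 H3 Ht) as [k [Hk4 [Hp Hq]]].
  exists k. split; [exact Hk4|]. now intros [].
Qed.

Lemma par_rho k : par (rho k) = false.
Proof. induction k as [|k IH]; [easy|]. simpl. now rewrite IH. Qed.

Lemma cls_rho_inj k k' :
  k < 4 -> k' < 4 -> cls (psi true (rho k)) = cls (psi true (rho k')) -> k = k'.
Proof.
  intros H H'. destruct (lt_4 H) as [->|[->|[->| ->]]], (lt_4 H') as [->|[->|[->| ->]]];
    easy.
Qed.

Definition lift (f g : word gen) (k : nat) : word gen :=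
  twist f ++ sigma_word g ++ rho k.

Lemma par_lift f g k : par (lift f g k) = false.
Proof. unfold lift. now rewrite !par_app, par_twist, par_sigma, par_rho. Qed.

Lemma psi_lift n f g k s :
  cls f = q1 -> cls g = q1 ->
  pres_eq (rels n) (psi s (lift f g k)) ((if s then g else f) ++ psi s (rho k)).
Proof.
  intros Hf Hg. unfold lift.
  rewrite !psi_app, par_twist, par_sigma, !xorb_false_r, psi_twist.
  destruct s.
  - rewrite psi_sigma. rewrite tau_trivial; [easy | now exists false].
  - rewrite app_assoc. fold (tau g). rewrite (tau_trivial n (w := g)); [| now exists false].
    now rewrite app_nil_r.
Qed.

Lemma cls_lift f g k : k < 4 -> cls f = q1 -> cls g = q1 -> cls (lift f g k) = q1.
Proof.
  intros Hk Hf Hg. rewrite cls_psi, par_lift.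
  (* Classes are invariants of [G_0], so the coordinates are computed at level 0. *)
  rewrite !(fun s => proj1 (phi0_resp (psi_lift 0 f g k s Hf Hg))), !cls_app, Hf, Hg.
  destruct (lt_4 Hk) as [->|[->|[->| ->]]]; reflexivity.
Qed.

(* The index of [H_n] in the kernel of [cls]. *)
Fixpoint ind (n : nat) : nat :=
  match n with
  | 0 => 1
  | S m => 4 * (ind m * ind m)
  end.

Lemma ind_pos n : 0 < ind n.
Proof. induction n; simpl; lia. Qed.

(** The quantity [4 * ind n] starts at 4 and is squared at each step. *)
Lemma ind_pow n : 16 * ind n = 2 ^ (2 ^ (n + 1) + 2).
Proof.
  assert (H : 4 * ind n = 2 ^ (2 ^ (n + 1))).
  { induction n as [|n IH]; [reflexivity|].
    replace (2 ^ (S n + 1)) with (2 ^ (n + 1) + 2 ^ (n + 1)) by (simpl; lia).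
    rewrite Nat.pow_add_r, <- IH. simpl ind. lia. }
  rewrite Nat.pow_add_r, <- H. simpl. lia.
Qed.

Lemma div_mod_split N a b : a < N -> (a + N * b) mod N = a /\ (a + N * b) / N = b.
Proof.
  intros H. rewrite (Nat.mul_comm N b), Nat.Div0.mod_add, Nat.mod_small, Nat.div_add by lia.
  split; [easy|]. rewrite Nat.div_small; lia.
Qed.

(** Mixed-radix digits, [i = k + 4 (a + ind m * b)]: the exponent [k] of [abab], then the indices of
    the second and first coordinates. *)
Fixpoint kreps (n i : nat) : word gen :=
  match n with
  | 0 => []
  | S m => lift (kreps m (i / 4 / ind m)) (kreps m ((i / 4) mod ind m)) (i mod 4)
  end.

Lemma cls_kreps n i : cls (kreps n i) = q1.
Proof.
  revert i; induction n as [|n IH]; intros i; [easy|].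
  apply cls_lift; auto. apply Nat.mod_upper_bound. lia.
Qed.

Lemma kreps_complete n w :
  cls w = q1 -> exists i, i < ind n /\ Hsub n (w ++ winv (kreps n i)).
Proof.
  revert w; induction n as [|n IH]; intros w Hw.
  { exists 0. split; [simpl; lia|]. simpl. now rewrite app_nil_r. }
  destruct (psi_q1_rho _ Hw) as [k [Hk Hrho]].
  assert (Hpw : par w = false) by (rewrite cls_psi in Hw; now injection Hw).
  (* Dividing by [rho k] brings both coordinates into the kernel of [cls]. *)
  assert (Hs : forall s, exists i, i < ind n /\
            Hsub n ((psi s w ++ winv (psi s (rho k))) ++ winv (kreps n i))).
  { intros s. apply IH. now rewrite cls_app, cls_winv, Hrho, qmul_Vr. }
  destruct (Hs true) as [i [Hi Hgi]], (Hs false) as [j [Hj Hfj]].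
  exists (k + 4 * (i + ind n * j)). split; [simpl; nia|].
  cbn [kreps].
  destruct (div_mod_split (i + ind n * j) Hk) as [-> ->].
  destruct (div_mod_split j Hi) as [-> ->].
  split; [now rewrite par_app, par_winv, par_lift, Hpw|].
  intros s. rewrite psi_app, psi_winv, par_lift, Hpw, !xorb_false_r.
  apply Hsub_resp with ((psi s w ++ winv (psi s (rho k))) ++ winv (kreps n (if s then i else j))).
  - rewrite <- app_assoc, <- winv_app. apply pres_eq_app_l, winv_resp.
    rewrite psi_lift by apply cls_kreps. now destruct s.
  - now destruct s.
Qed.

Lemma kreps_inj n i j :
  i < ind n -> j < ind n -> Hsub n (kreps n i ++ winv (kreps n j)) -> i = j.
Proof.
  revert i j; induction n as [|n IH]; intros i j Hi Hj; [simpl in *; lia|].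
  cbn [kreps]. intros [_ Hs].
  pose proof (ind_pos n) as Hpos. simpl in Hi, Hj.
  assert (Hd : forall i, i < 4 * (ind n * ind n) ->
    i mod 4 < 4 /\ i / 4 mod ind n < ind n /\ i / 4 / ind n < ind n).
  { intros l Hl. repeat split; try (apply Nat.mod_upper_bound; lia).
    apply Nat.Div0.div_lt_upper_bound, Nat.Div0.div_lt_upper_bound. lia. }
  destruct (Hd i Hi) as [Hi1 [Hi2 Hi3]], (Hd j Hj) as [Hj1 [Hj2 Hj3]].
  pose proof (Nat.div_mod_eq i 4) as Ei. pose proof (Nat.div_mod_eq (i / 4) (ind n)) as Ei'.
  pose proof (Nat.div_mod_eq j 4) as Ej. pose proof (Nat.div_mod_eq (j / 4) (ind n)) as Ej'.
  revert Hs Hi1 Hi2 Hi3 Hj1 Hj2 Hj3 Ei Ei' Ej Ej'.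
  generalize (i mod 4) as k, (i / 4 mod ind n) as a, (i / 4 / ind n) as b,
    (j mod 4) as k', (j / 4 mod ind n) as a', (j / 4 / ind n) as b'.
  intros k a b k' a' b' Hs Hi1 Hi2 Hi3 Hj1 Hj2 Hj3 Ei Ei' Ej Ej'.
  assert (Hs' : forall s : bool, Hsub n
    ((kreps n (if s then a else b) ++ psi s (rho k)) ++
     winv (kreps n (if s then a' else b') ++ psi s (rho k')))).
  { intros s. eapply Hsub_resp; [|exact (Hs s)].
    rewrite psi_app, psi_winv, !par_lift, !xorb_false_r.
    rewrite psi_lift by apply cls_kreps. apply pres_eq_app; [now destruct s|].
    apply winv_resp. rewrite psi_lift by apply cls_kreps. now destruct s. }
  (* Representatives and elements of [H_n] have trivial class, so the class of the second coordinate
     determines [k]. *)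
  assert (Hk : k = k').
  { apply cls_rho_inj; auto. pose proof (Hsub_cls _ _ (Hs' true)) as H.
    rewrite !cls_app, cls_winv, cls_app, !cls_kreps, !qmul_1l in H.
    rewrite <- (qmul_1l (cls (psi true (rho k')))), <- H, <- qmul_assoc, qmul_Vl.
    now rewrite qmul_1r. }
  subst k'.
  assert (Hs'' : forall s : bool, Hsub n
    (kreps n (if s then a else b) ++ winv (kreps n (if s then a' else b')))).
  { intros s. eapply Hsub_resp; [|exact (Hs' s)].
    rewrite winv_app, <- app_assoc, (app_assoc (psi s (rho k))). now rewrite winv_r. }
  assert (a = a') by now apply IH, (Hs'' true).
  assert (b = b') by now apply IH, (Hs'' false).
  subst. congruence.
Qed.

Definition qdecode (k : nat) : Q :=
  (Nat.testbit k 0, Nat.testbit k 1, Nat.testbit k 2, Nat.testbit k 3).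

Definition qencode (q : Q) : nat :=
  let '(s, x, y, g) := q in
  Nat.b2n s + 2 * (Nat.b2n x + 2 * (Nat.b2n y + 2 * Nat.b2n g)).

Lemma qencode_lt q : qencode q < 16.
Proof. cases; simpl; lia. Qed.

Lemma qencodeK q : qdecode (qencode q) = q.
Proof. cases; reflexivity. Qed.

Lemma qdecodeK k : k < 16 -> qencode (qdecode k) = k.
Proof. intros H. do 16 (destruct k as [|k]; [reflexivity|]). lia. Qed.

Lemma Hsub_index n : has_index (rels n) (Hsub n) (2 ^ (2 ^ (n + 1) + 2)).
Proof.
  rewrite <- ind_pow.
  exists (fun i => kreps n (i / 16) ++ sect (qdecode (i mod 16))). split.
  - intros w.
    destruct (@kreps_complete n (w ++ winv (sect (cls w)))) as [i [Hi H]].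
    { now rewrite cls_app, cls_winv, cls_sect, qmul_Vr. }
    exists (qencode (cls w) + 16 * i).
    destruct (div_mod_split i (qencode_lt (cls w))) as [-> ->].
    split; [pose proof (qencode_lt (cls w)); lia|].
    now rewrite qencodeK, winv_app, app_assoc.
  - intros i j Hi Hj H.
    rewrite winv_app in H.
    pose proof (Hsub_cls _ _ H) as Hc.
    rewrite !cls_app, !cls_winv, !cls_sect, !cls_kreps, qmul_1l, qmul_1r in Hc.
    assert (Hq : qdecode (i mod 16) = qdecode (j mod 16)).
    { rewrite <- (qmul_1l (qdecode (j mod 16))), <- Hc, <- qmul_assoc, qmul_Vl.
      now rewrite qmul_1r. }
    assert (Hm : i mod 16 = j mod 16).
    { rewrite <- (@qdecodeK (i mod 16)), <- (@qdecodeK (j mod 16)), Hq;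
        [easy | apply Nat.mod_upper_bound; lia ..]. }
    rewrite (Nat.div_mod_eq i 16), (Nat.div_mod_eq j 16), Hm. do 2 f_equal.
    apply (@kreps_inj n).
    + apply Nat.Div0.div_lt_upper_bound; lia.
    + apply Nat.Div0.div_lt_upper_bound; lia.
    + eapply Hsub_resp; [|exact H].
      rewrite Hq, <- app_assoc, (app_assoc (sect _)). now rewrite winv_r.
Qed.

(** * The isomorphism with a product of free groups *)

(** The binary digits of [i], lowest first, choose the coordinate at each level. *)
Fixpoint phi (n : nat) (w : word gen) (i : nat) : word gen3 :=
  match n with
  | 0 => phi0 q1 w
  | S m => phi m (psi (Nat.odd i) w) (Nat.div2 i)
  end.

Lemma phi_resp n u v :
  pres_eq (rels n) u v -> forall i, F3_eq (phi n u i) (phi n v i).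
Proof.
  revert u v; induction n as [|n IH]; intros u v E i; simpl.
  - apply (phi0_resp E).
  - apply IH, (psi_resp E).
Qed.

Lemma phi_app n u v : Hsub n u -> forall i, phi n (u ++ v) i = phi n u i ++ phi n v i.
Proof.
  revert u v; induction n as [|n IH]; intros u v; simpl.
  - intros Hu _. now rewrite phi0_app, Hu.
  - intros [Hp Hs] i. rewrite psi_app, Hp, xorb_false_r. now apply IH.
Qed.

Lemma phi_injective n u :
  Hsub n u -> (forall i, i < 2 ^ n -> F3_eq (phi n u i) []) -> pres_eq (rels n) u [].
Proof.
  revert u; induction n as [|n IH]; intros u Hu H.
  - rewrite (normal_form 0 u), (back_resp 0 (H 0 ltac:(simpl; lia))), Hu. reflexivity.
  - destruct Hu as [Hp Hs]. apply psi_injective; [exact Hp|].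
    intros s. apply IH; [apply Hs|]. intros i Hi.
    (* The factor reached by choosing coordinate [s] first and then following [i]. *)
    specialize (H (Nat.b2n s + 2 * i)). cbn [phi] in H.
    rewrite Nat.div2_div, Nat.add_b2n_double_div2 in H.
    replace (Nat.odd (Nat.b2n s + 2 * i)) with s in H
      by (rewrite <- Nat.bit0_odd; symmetry; apply Nat.add_b2n_double_bit0).
    apply H. simpl. destruct s; simpl; lia.
Qed.

Lemma phi_surjective n g :
  exists u, Hsub n u /\ forall i, i < 2 ^ n -> F3_eq (phi n u i) (g i).
Proof.
  revert g; induction n as [|n IH]; intros g.
  - exists (back (g 0)). split; [apply cls_back|].
    intros i Hi. simpl in Hi. replace i with 0 by lia. simpl. now rewrite phi0_back.
  (* Odd indices belong to the second coordinate, even ones to the first; the lift with [k = 0] has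
     exactly the prescribed coordinates. *)
  - destruct (IH (fun i => g (2 * i + 1))) as [w1 [Hw1 E1]].
    destruct (IH (fun i => g (2 * i))) as [w0 [Hw0 E0]].
    assert (Hpsi : forall s,
      pres_eq (rels n) (psi s (lift w0 w1 0)) (if s then w1 else w0)).
    { intros s. rewrite psi_lift by now apply (@Hsub_cls n).
      simpl. now rewrite app_nil_r. }
    exists (lift w0 w1 0). split.
    + split; [apply par_lift|]. intros s.
      apply (Hsub_resp (u := if s then w1 else w0)); [|now destruct s].
      symmetry. apply Hpsi.
    + intros i Hi. cbn [phi]. eapply pe_trans; [apply (phi_resp (Hpsi _))|].
      pose proof (Nat.div2_odd i) as Ei. simpl in Hi.
      destruct (Nat.odd i); simpl Nat.b2n in Ei.
      * rewrite E1 by lia. now rewrite <- Ei.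
      * rewrite E0 by lia. now rewrite <- (Nat.add_0_r (2 * _)), <- Ei.
Qed.

Theorem theorem1p7 : forall n : nat,
  exists H : word gen -> Prop,
    normal_subgroup (rels n) H /\
    has_index (rels n) H (2 ^ (2 ^ (n + 1) + 2)) /\
    iso_prod_F3 (rels n) H (2 ^ n).
Proof.
  intros n. exists (Hsub n).
  split; [apply Hsub_normal|]. split; [apply Hsub_index|].
  exists (phi n). split; [|split; [|split]].
  - intros u v _ E i _. now apply phi_resp.
  - intros u v Hu _ i _. now rewrite phi_app.
  - apply phi_injective.
  - apply phi_surjective.
Qed.
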